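(* Let $p$ be a prime, let $k\ge 1$ and $1\le\alpha_1\le\alpha_2\le\dots\le\alpha_k$ be integers, and let $G=\prod_{i=1}^k\mathbb{Z}_{p^{\alpha_i}}$ (direct product of cyclic groups), a finite abelian $p$-group. Then $$\psi'(G)=p^{\;\alpha_k\,p^{\alpha_1+\alpha_2+\dots+\alpha_k}-\sum_{i=0}^{\alpha_k-1}p^i f_{(\alpha_1,\alpha_2,\dots,\alpha_k)}(i)},$$ where $$f_{(\alpha_1,\alpha_2,\dots,\alpha_k)}(i)=\begin{cases}p^{(k-1)i}, & 0\le i\le\alpha_1,\\ p^{(k-2)i+\alpha_1}, & \alpha_1\le i\le\alpha_2,\\ p^{(k-3)i+\alpha_1+\alpha_2}, & \alpha_2\le i\le\alpha_3,\\ \ \ \vdots & \\ p^{\alpha_1+\alpha_2+\dots+\alpha_{k-1}}, & i\ge\alpha_{k-1}.\end{cases}$$ That is, with $\alpha_0=0$, for $k\ge 2$: $f_{(\alpha_1,\dots,\alpha_k)}(i)=p^{(k-1-j)i+\alpha_1+\dots+\alpha_j}$ if $\alpha_j\le i\le\alpha_{j+1}$ with $0\le j\le k-2$, and $f_{(\alpha_1,\dots,\alpha_k)}(i)=p^{\alpha_1+\dots+\alpha_{k-1}}$ if $i\ge\alpha_{k-1}$. For $k=1$, $f_{(\alpha_1)}(i)=1$ for all $i\ge 0$.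
   Context: For a finite group $G$, $\psi'(G)=\prod_{x\in G}o(x)$ denotes the product of the orders of all elements of $G$, where $o(x)$ is the order of $x\in G$. $\mathbb{Z}_m$ denotes the cyclic group of order $m$. *)

(* Defs.v *)
From mathcomp Require Import all_boot all_order all_algebra all_fingroup.
From mathcomp Require Import zify.

Set Implicit Arguments.
Unset Strict Implicit.
Unset Printing Implicit Defensive.

Definition psi' (gT : finGroupType) (G : {group gT}) : nat :=
  \prod_(x in G) #[x]%g.

(* 'Z_n is the additive cyclic group of order n only for n > 1, which holds
   here as soon as p is prime and every alpha_i is positive. *)
Definition cyclic_prod (p k : nat) (alpha : k.-tuple nat) :=
  [set: {dffun forall i : 'I_k, 'Z_(p ^ tnth alpha i)}]%G.

(* 1-based indexing, with alpha_0 = 0. *)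
Definition alpha_nth (k : nat) (alpha : k.-tuple nat) (j : nat) : nat :=
  nth 0 (0 :: alpha) j.

(* alpha_1 + ... + alpha_j *)
Definition alpha_sum (k : nat) (alpha : k.-tuple nat) (j : nat) : nat :=
  \sum_(1 <= l < j.+1) alpha_nth alpha l.

(* The least j in {0, ..., k - 2} such that i <= alpha_(j+1), or k - 1 if there
   is none. The closed ranges alpha_j <= i <= alpha_(j+1) of the piecewise
   definition overlap at their endpoints; the lemmas f_alpha_mid, f_alpha_last
   and f_alpha1 below show that the choice is immaterial. *)
Definition piece (k : nat) (alpha : k.-tuple nat) (i : nat) : nat :=
  find (fun j => i <= alpha_nth alpha j.+1) (iota 0 k.-1).

Definition f_alpha (p k : nat) (alpha : k.-tuple nat) (i : nat) : nat :=
  let j := piece alpha i in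
  p ^ ((k.-1 - j) * i + alpha_sum alpha j).

Lemma alpha_nth_le (k : nat) (alpha : k.-tuple nat) (a b : nat) :
  sorted leq alpha -> a <= b -> b <= k -> alpha_nth alpha a <= alpha_nth alpha b.
Proof.
move=> s_alpha le_ab le_bk.
have s0 : sorted leq (0 :: alpha).
  by case: (tval alpha) s_alpha => //= x s ->.
apply: (sorted_leq_nth leq_trans leqnn 0 s0) => //;
  by rewrite inE /= size_tuple ltnS // (leq_trans le_ab).
Qed.

Lemma piece_flat (p k : nat) (alpha : k.-tuple nat) (i j : nat) :
    sorted leq alpha -> j <= k.-1 -> alpha_nth alpha j <= i ->
    (j < k.-1 -> i <= alpha_nth alpha j.+1) ->
  f_alpha p alpha i = p ^ ((k.-1 - j) * i + alpha_sum alpha j).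
Proof.
move=> s_alpha le_jk ge_i le_i; rewrite /f_alpha /piece.
set P := fun j => _; set q := find P _.
have le_qj : q <= j.
  rewrite leqNgt; apply/negP => lt_jq.
  have lt_jk: j < k.-1.
    by apply: leq_trans lt_jq _; rewrite -[k.-1](size_iota 0) find_size.
  by have := before_find 0 lt_jq; rewrite nth_iota // /P add0n le_i.
have eq_i l : q < l <= j -> alpha_nth alpha l = i.
  case/andP=> lt_ql le_lj; apply/eqP; rewrite eqn_leq.
  rewrite (leq_trans (alpha_nth_le s_alpha le_lj _) ge_i) /=; last by lia.
  have lt_qk : q < k.-1 by lia.
  have := @nth_find _ 0 P (iota 0 k.-1); rewrite has_find size_iota -/q lt_qk.
  move=> /(_ isT); rewrite nth_iota // add0n /P => /leq_trans; apply.
  by apply: alpha_nth_le => //; lia.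
congr (p ^ _); rewrite /alpha_sum (@big_cat_nat _ _ _ q.+1 1 j.+1) //=.
have -> : \sum_(q.+1 <= l < j.+1) alpha_nth alpha l = (j - q) * i.
  rewrite (eq_big_nat _ _ (F2 := fun=> i)); last exact: eq_i.
  by rewrite sum_nat_const_nat subSS.
have -> : k.-1 - q = (k.-1 - j) + (j - q) by lia.
by rewrite mulnDl addnAC addnA.
Qed.

Lemma f_alpha_mid (p k : nat) (alpha : k.-tuple nat) (i j : nat) :
    sorted leq alpha -> 2 <= k -> j <= k - 2 ->
    alpha_nth alpha j <= i <= alpha_nth alpha j.+1 ->
  f_alpha p alpha i = p ^ ((k - 1 - j) * i + alpha_sum alpha j).
Proof.
move=> s_alpha k_ge2 le_jk /andP[ge_i le_i]; rewrite subn1.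
by apply: piece_flat => //; lia.
Qed.

Lemma f_alpha_last (p k : nat) (alpha : k.-tuple nat) (i : nat) :
    sorted leq alpha -> 2 <= k -> alpha_nth alpha (k - 1) <= i ->
  f_alpha p alpha i = p ^ alpha_sum alpha (k - 1).
Proof.
move=> s_alpha k_ge2 ge_i.
by rewrite (@piece_flat p _ _ _ k.-1) // -?subn1 ?subnn ?ltnn.
Qed.

Lemma f_alpha1 (p : nat) (alpha : 1.-tuple nat) (i : nat) :
  f_alpha p alpha i = 1.
Proof. by rewrite /f_alpha /piece /= /alpha_sum big_geq. Qed.

(* Main.v *)
Require Import Defs.
From mathcomp Require Import all_boot all_order all_algebra all_fingroup.
From mathcomp Require Import cyclic zify.

(** Write o(x) = p^l. Among the exponents i < m, where p^m kills G, exactly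
    m - l satisfy x^(p^i) = 1, so o(x) times p to that number is p^m; taking the
    product over x expresses psi'(G) by the numbers of solutions of x^(p^i) = 1.
    In a product of cyclic groups of orders p^(alpha_j), that number is the
    product of the gcd(p^i, p^(alpha_j)), which is p^i f_alpha(i). *)

Set Implicit Arguments.
Unset Strict Implicit.

Local Open Scope ring_scope.

(** The solutions form the unique subgroup of order [d = gcdn n #|G|]: for x in [G], o(x) divides n
    exactly when it divides d. *)
Lemma card_expg_eq1_cyclic (gT : finGroupType) (G : {group gT}) (n : nat) :
  cyclic G -> #|[set x in G | x ^+ n == 1]%g| = gcdn n #|G|.
Proof.
move=> cycG; have [g defG] := cyclicP cycG.
set d := gcdn n #|G|.
have d_dvd_g : (d %| #[g]%g)%N by rewrite orderE -defG dvdn_gcdr.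
have gX : (g ^+ (#[g] %/ d) \in G)%g by rewrite defG mem_cycle.
have o_gX : #[g ^+ (#[g] %/ d)]%g = d.
  by rewrite orderXdiv ?dvdn_div // divnA // mulKn // order_gt0.
suff -> : [set x in G | x ^+ n == 1]%g = <[g ^+ (#[g] %/ d)]>%g.
  by rewrite -orderE o_gX.
apply/setP=> x; rewrite inE -order_dvdn.
have [Gx | notGx] /= := boolP (x \in G); last first.
  by apply/esym/negbTE; apply: contra notGx; apply/subsetP; rewrite cycle_subG.
(* In a cyclic group, inclusion between subgroups amounts to divisibility of their orders. *)
rewrite -cycle_subG -(cardSg_cyclic cycG) ?cycle_subG // -!orderE o_gX.
by rewrite dvdn_gcd order_dvdG // andbT.
Qed.

Lemma dffun_expg (I : finType) (gT : I -> finGroupType)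
    (x : {dffun forall i, gT i}) (n : nat) (i : I) :
  ((x ^+ n) i = x i ^+ n)%g.
Proof.
elim: n => [|n IHn]; first by rewrite !expg0 ffunE.
by rewrite !expgS ffunE IHn.
Qed.

(** Powers are taken componentwise, so the solution set is a full product of the componentwise
    solution sets. *)
Lemma card_expg_eq1_dffun (I : finType) (gT : I -> finGroupType) (n : nat) :
  #|[set x : {dffun forall i, gT i} | x ^+ n == 1]%g| =
  (\prod_i #|[set y : gT i | y ^+ n == 1]%g|)%N.
Proof.
pose F i := [pred y : gT i | y ^+ n == 1]%g.
have := card_family F; rewrite foldrE big_image /= => cF.
rewrite (eq_bigr (fun i => #|F i|)) -?cF; last first.
  by move=> i _; apply: eq_card => y; rewrite !inE.
apply: eq_card => x; rewrite inE.
apply/eqP/familyP => [xn1 i | xn1]; first by rewrite inE -dffun_expg xn1 ffunE.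
by apply/ffunP=> i; rewrite dffun_expg ffunE; apply/eqP; have := xn1 i.
Qed.

Lemma sum_nat_geq (l m : nat) :
  (l <= m)%N -> (\sum_(0 <= i < m) (l <= i) = m - l)%N.
Proof.
move=> le_lm; rewrite (@big_cat_nat _ _ _ l) //=.
rewrite big_nat big1 => [|i /andP[_ lt_il]]; last by rewrite leqNgt lt_il.
rewrite big_nat (eq_bigr (fun=> 1%N)) => [|i /andP[-> //]].
by rewrite -big_nat sum_nat_const_nat muln1.
Qed.

Lemma order_mul_expn_count (gT : finGroupType) (x : gT) (p m : nat) :
  prime p -> (x ^+ (p ^ m) = 1)%g ->
  (#[x]%g * p ^ (\sum_(0 <= i < m) (x ^+ (p ^ i) == 1)%g) = p ^ m)%N.
Proof.
move=> p_pr /eqP; rewrite -order_dvdn => /dvdn_pfactor[] // l le_lm ox.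
under eq_bigr => i _ do rewrite -order_dvdn ox dvdn_Pexp2l ?prime_gt1 //.
by rewrite sum_nat_geq // ox -expnD subnKC.
Qed.

(** Double counting of the pairs (i, x) with x^(p^i) = 1. Keeping the count as a factor on the left
    avoids truncated subtraction in [nat]. *)
Lemma psi'_mul_expn_count (gT : finGroupType) (G : {group gT}) (p m : nat) :
  prime p -> {in G, forall x, x ^+ (p ^ m) = 1}%g ->
  (psi' G * p ^ (\sum_(0 <= i < m) #|[set x in G | x ^+ (p ^ i) == 1]%g|) =
   p ^ (m * #|G|))%N.
Proof.
move=> p_pr Gpm.
under eq_bigr => i _.
  rewrite -sum1_card (eq_bigl (fun x => (x \in G) && (x ^+ (p ^ i) == 1)%g)).
    rewrite big_mkcondr. over.
  by move=> x; rewrite inE.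
rewrite exchange_big /= expn_sum -big_split /= expnM -prod_nat_const.
apply: eq_bigr => x Gx; rewrite -[RHS](order_mul_expn_count p_pr (Gpm x Gx)).
congr (_ * p ^ _)%N; apply: eq_bigr => i _; by case: eqP.
Qed.

Lemma alpha_sum_tnth (k : nat) (alpha : k.-tuple nat) :
  alpha_sum alpha k = (\sum_(j < k) tnth alpha j)%N.
Proof.
rewrite /alpha_sum big_add1 /= big_mkord.
by apply: eq_bigr => j _; rewrite /alpha_nth (tnth_nth 0%N).
Qed.

Lemma tnth_le_alpha_nth (k : nat) (alpha : k.-tuple nat) (j : 'I_k) :
  sorted leq alpha -> (tnth alpha j <= alpha_nth alpha k)%N.
Proof.
move=> s_alpha; rewrite (tnth_nth 0%N).
exact: (@alpha_nth_le k alpha j.+1 k).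
Qed.

(** With q = [piece alpha i], the minimum is alpha_j for the first q indices and i for the other k -
    q, so the exponents add up to [alpha_sum alpha q] + (k - q) i. *)
Lemma expn_mul_f_alpha (p k : nat) (alpha : k.-tuple nat) (i : nat) :
  sorted leq alpha -> (0 < k)%N -> (i <= alpha_nth alpha k)%N ->
  (p ^ i * f_alpha p alpha i = \prod_(j < k) p ^ minn i (tnth alpha j))%N.
Proof.
move=> s_alpha k_gt0 le_i; rewrite /f_alpha -expn_sum -expnD; congr (p ^ _)%N.
set q := piece alpha i.
have le_qk : (q <= k.-1)%N by rewrite -[k.-1](size_iota 0) find_size.
(* If the search fails, q is the default k - 1 and the bound is the hypothesis i <= alpha_k. *)
have le_iq : (i <= alpha_nth alpha q.+1)%N.
  have [lt_qk | ge_qk] := ltnP q k.-1; last first.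
    by have -> : q.+1 = k by lia.
  have := @nth_find _ 0%N _ (iota 0 k.-1).
  move/(_ (fun j => (i <= alpha_nth alpha j.+1)%N)).
  by rewrite has_find size_iota nth_iota //; apply.
transitivity (\sum_(0 <= j < k) minn i (alpha_nth alpha j.+1))%N; last first.
  rewrite big_mkord; apply: eq_bigr => j _.
  by rewrite /alpha_nth (tnth_nth 0%N).
rewrite (@big_cat_nat _ _ _ q) //=; last by lia.
have -> : (\sum_(q <= j < k) minn i (alpha_nth alpha j.+1) = (k - q) * i)%N.
  rewrite (eq_big_nat _ _ (F2 := fun=> i)) ?sum_nat_const_nat //.
  move=> j /andP[le_qj lt_jk].
  by apply/minn_idPl/(leq_trans le_iq)/alpha_nth_le.
have -> : (\sum_(0 <= j < q) minn i (alpha_nth alpha j.+1) =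
         alpha_sum alpha q)%N.
  rewrite /alpha_sum big_add1; apply: eq_big_nat => j /andP[_ lt_jq].
  apply/minn_idPr; have := before_find 0%N lt_jq.
  by rewrite nth_iota ?(leq_trans lt_jq) // add0n; lia.
(* The extra copy of i is the exponent of the factor [p ^ i]. *)
have -> : (k - q = (k.-1 - q).+1)%N by lia.
by rewrite mulSn addnA addnC.
Qed.

Lemma card_expg_eq1_cyclic_prod (p k : nat) (alpha : k.-tuple nat) (i : nat) :
  prime p -> (forall j : 'I_k, (1 <= tnth alpha j)%N) ->
  #|[set x in cyclic_prod p alpha | x ^+ (p ^ i) == 1]%g| =
  (\prod_(j < k) p ^ minn i (tnth alpha j))%N.
Proof.
move=> p_pr alpha_ge1.
transitivity #|[set x : {dffun forall j : 'I_k, 'Z_(p ^ tnth alpha j)}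
                 | x ^+ (p ^ i) == 1]%g|.
  by apply: eq_card => x; rewrite !inE.
rewrite card_expg_eq1_dffun; apply: eq_bigr => j _.
have p_gt1 := prime_gt1 p_pr.
have cycZ : cyclic [set: 'Z_(p ^ tnth alpha j)].
  by apply/cyclicP; exists Zp1; rewrite Zp_cycle.
transitivity #|[set y in [set: 'Z_(p ^ tnth alpha j)] | y ^+ (p ^ i) == 1]%g|.
  by apply: eq_card => y; rewrite !inE.
rewrite (@card_expg_eq1_cyclic _ [set: _]%G) // cardsT card_ord.
(* Positivity of the exponent gives modulus > 1, so that ['Z_] of it really has that many
   elements. *)
by rewrite expn_min Zp_cast // -[1%N](expn0 p) ltn_exp2l.
Qed.

Theorem theoremB (p k : nat) (alpha : k.-tuple nat)
    (p_prime : prime p) (k_ge1 : (1 <= k)%N)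
    (alpha_ge1 : forall i : 'I_k, (1 <= tnth alpha i)%N)
    (alpha_sorted : sorted leq alpha) :
  (psi' (cyclic_prod p alpha))%:R =
  (p%:R : rat) ^
    (Posz (alpha_nth alpha k * p ^ alpha_sum alpha k)%N
     - Posz (\sum_(0 <= i < alpha_nth alpha k) p ^ i * f_alpha p alpha i)%N).
Proof.
set m := alpha_nth alpha k; set S := (\sum_(0 <= i < m) _)%N.
have card_sol i : (i <= m)%N ->
    #|[set x in cyclic_prod p alpha | x ^+ (p ^ i) == 1]%g| =
      (p ^ i * f_alpha p alpha i)%N.
  by move=> le_im; rewrite card_expg_eq1_cyclic_prod // expn_mul_f_alpha.
(* At i = m = alpha_k, the largest exponent, every minimum is alpha_j. *)
have card_ker :
    #|[set x in cyclic_prod p alpha | x ^+ (p ^ m) == 1]%g| =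
    (p ^ alpha_sum alpha k)%N.
  rewrite card_expg_eq1_cyclic_prod // alpha_sum_tnth expn_sum.
  by apply: eq_bigr => j _; rewrite (minn_idPr _) // tnth_le_alpha_nth.
have card_G : #|cyclic_prod p alpha| = (p ^ alpha_sum alpha k)%N.
  rewrite cardsT card_dep_ffun foldrE big_image /= alpha_sum_tnth expn_sum.
  apply: eq_bigr => j _; rewrite card_ord Zp_cast //.
  by rewrite -[1%N](expn0 p) ltn_exp2l // prime_gt1.
(* The solutions of x^(p^m) = 1 are as many as the elements of the group, so p^m kills it. *)
have Gpm : {in cyclic_prod p alpha, forall x, x ^+ (p ^ m) = 1}%g.
  have : [set x in cyclic_prod p alpha | x ^+ (p ^ m) == 1]%g ==
         cyclic_prod p alpha.
    rewrite eqEcard card_ker card_G leqnn andbT.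
    by apply/subsetP=> x; rewrite inE => /andP[].
  by move=> /eqP ker_G x; rewrite -ker_G inE => /andP[_ /eqP].
have := psi'_mul_expn_count p_prime Gpm; rewrite card_G.
rewrite (eq_big_nat _ _ (F2 := fun i => p ^ i * f_alpha p alpha i)%N);
  last first.
  by move=> i /andP[_ /ltnW/card_sol].
rewrite -/S => /(congr1 (fun n => n%:R : rat)).
rewrite GRing.natrM !GRing.natrX => psi_eq.
(* The product identity now holds in [rat], where dividing by p^S gives the integer exponent. *)
have p_neq0 : (p%:R : rat) != 0 by rewrite Num.Theory.pnatr_eq0 -lt0n prime_gt0.
by rewrite expfzDr // -exprnP -psi_eq -exprnN GRing.mulfK // GRing.expf_neq0.
Qed.
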